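(* Let $N=1$ (one conserved moment) and let $(\boldsymbol{m}^n)_{n\in\mathbb{N}}$ be given by the lattice Boltzmann scheme $\boldsymbol{m}^{n+1}=\boldsymbol{A}\boldsymbol{m}^n+\boldsymbol{B}\,\boldsymbol{m}^{\mathrm{eq}}|^{n}$. Let $\chi_{\boldsymbol{A}}=\sum_{k=0}^{q}\gamma_k X^k$, with $\gamma_0,\dots,\gamma_q\in\mathcal{D}$, be the characteristic polynomial of $\boldsymbol{A}$. Then the scheme corresponds to a multi-step explicit Finite Difference scheme on the conserved moment $m_1$: for every integer $n\ge q-1$, $$m_1^{n+1}=-\sum_{k=0}^{q-1}\gamma_k\, m_1^{n+1-q+k}+\left(\sum_{k=0}^{q-1}\left(\sum_{\ell=0}^{k}\gamma_{q+\ell-k}\,\boldsymbol{A}^{\ell}\right)\boldsymbol{B}\,\boldsymbol{m}^{\mathrm{eq}}|^{n-k}\right)_1 .$$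
   Context: Lattice and operators: $d\in\{1,2,3\}$, $\Delta x>0$, $\mathcal{L}=\Delta x\,\mathbb{Z}^d$. For $\boldsymbol z\in\mathbb{Z}^d$ the shift $T^{\boldsymbol z}$ acts on functions $f:\mathcal{L}\to\mathbb{R}$ by $(T^{\boldsymbol z}f)(\boldsymbol x)=f(\boldsymbol x-\boldsymbol z\Delta x)$. $\mathcal{D}$ denotes the commutative ring of Finite Difference operators, i.e. finite real linear combinations of shifts, with composition $T^{\boldsymbol z}\circ T^{\boldsymbol w}=T^{\boldsymbol z+\boldsymbol w}$ as product (the group ring $\mathbb{R}[\mathbb{Z}^d]$). Matrices over $\mathcal{D}$ act on vectors of functions on $\mathcal{L}$ in the obvious way. Lattice Boltzmann scheme: $q\in\mathbb{N}$, number of conserved moments $N\in\{1,\dots,q-1\}$, velocities $\boldsymbol c_1,\dots,\boldsymbol c_q\in\mathbb{Z}^d$, an invertible moment matrix $\boldsymbol M\in\mathrm{GL}_q(\mathbb{R})$, a relaxation matrix $\boldsymbol S=\mathrm{diag}(0,\dots,0,s_{N+1},\dots,s_q)$ ($N$ leading zeros, $s_i\in\,]0,2]$), and a possibly nonlinear function $\boldsymbol m^{\mathrm{eq}}:\mathbb{R}^N\to\mathbb{R}^q$. Put $\boldsymbol T=\boldsymbol M\,\mathrm{diag}(T^{\boldsymbol c_1},\dots,T^{\boldsymbol c_q})\boldsymbol M^{-1}$, $\boldsymbol A=\boldsymbol T(\boldsymbol I-\boldsymbol S)$, $\boldsymbol B=\boldsymbol T\boldsymbol S$, all in $\mathcal{M}_q(\mathcal{D})$.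 The moments $\boldsymbol m^n=(m_1^n,\dots,m_q^n)^{\mathsf T}$, $m_j^n:\mathcal{L}\to\mathbb{R}$, evolve from arbitrary initial data $\boldsymbol m^0$ by $\boldsymbol m^{n+1}=\boldsymbol A\boldsymbol m^n+\boldsymbol B\,\boldsymbol m^{\mathrm{eq}}|^n$, $n\in\mathbb{N}$, where $\boldsymbol m^{\mathrm{eq}}|^n(\boldsymbol x)=\boldsymbol m^{\mathrm{eq}}(m_1^n(\boldsymbol x),\dots,m_N^n(\boldsymbol x))$. The characteristic polynomial of $\boldsymbol C\in\mathcal{M}_r(\mathcal{R})$ over a commutative ring $\mathcal{R}$ is $\chi_{\boldsymbol C}=(-1)^r\det(\boldsymbol C-X\boldsymbol I)\in\mathcal{R}[X]$ (monic). $(\cdot)_1$ denotes the first component of a vector. *)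

(* Defs.v *)
From HB Require Import structures.
From mathcomp Require Import all_boot all_order all_algebra.
From mathcomp Require Import boolp classical_sets functions reals.

Set Implicit Arguments.
Unset Strict Implicit.
Unset Printing Implicit Defensive.

Import Order.TTheory GRing.Theory Num.Theory.

Local Open Scope ring_scope.

Section Lattice.
Context {R : realType} {d : nat} (dx : R).

Definition scaled (z : 'rV[int]_d) : 'rV[R]_d := dx *: map_mx intr z.

Definition in_lattice : {pred 'rV[R]_d} :=
  fun x => `[< exists z : 'rV[int]_d, x = scaled z >].

Lemma in_lattice_zmod : zmod_closed in_lattice.
Proof.
split=> [|x y /asboolP[u ->] /asboolP[v ->]]; apply/asboolP.
  by exists 0; rewrite /scaled map_mx0 scaler0.
by exists (u - v); rewrite /scaled map_mxB scalerBr.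
Qed.

HB.instance Definition _ :=
  GRing.isZmodClosed.Build 'rV[R]_d in_lattice in_lattice_zmod.

(* The grid dx * Z^d, as a subgroup of R^d. *)
Record lattice := Lattice {
  lattice_val :> 'rV[R]_d;
  _ : lattice_val \in in_lattice }.

HB.instance Definition _ := [isSub for lattice_val].
HB.instance Definition _ := [Choice of lattice by <:].
HB.instance Definition _ := [SubChoice_isSubZmodule of lattice by <:].

Lemma scaledP (z : 'rV[int]_d) : scaled z \in in_lattice.
Proof. by apply/asboolP; exists z. Qed.

Definition lattice_pt (z : 'rV[int]_d) : lattice := Lattice (scaledP z).

Lemma lattice_pt0 : lattice_pt 0 = 0.
Proof. by apply/val_inj; rewrite /= /scaled map_mx0 scaler0. Qed.

Lemma lattice_ptD z w : lattice_pt (z + w) = lattice_pt z + lattice_pt w.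
Proof. by apply/val_inj; rewrite /= /scaled map_mxD scalerDr. Qed.

(* The codomain is R^o, i.e. R as a module over itself, so that functions on
   the lattice form an R-module. *)
Definition shift (z : 'rV[int]_d) (f : lattice -> R^o) : lattice -> R^o :=
  fun x => f (x - lattice_pt z).

Lemma shift0 f : shift 0 f = f.
Proof. by apply/funext => x; rewrite /shift lattice_pt0 subr0. Qed.

Lemma shiftD z w f : shift (z + w) f = shift z (shift w f).
Proof. by apply/funext => x; rewrite /shift lattice_ptD opprD addrA. Qed.

Lemma shift_is_linear z : linear (shift z).
Proof. by []. Qed.

HB.instance Definition _ z :=
  GRing.isLinear.Build R (lattice -> R^o) (lattice -> R^o) _ (shift z)
    (shift_is_linear z).

End Lattice.

Arguments lattice {R} d dx.

Section FDOperators.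
Context {R : realType} {d : nat} {dx : R}.
Local Notation L := (lattice d dx).
Local Notation F := (L -> R^o).

Definition shift_comb (s : seq (R * 'rV[int]_d)) : F -> F :=
  fun f => \sum_(p <- s) p.1 *: shift p.2 f.

Definition is_fdop : {pred F -> F} :=
  fun D => `[< exists s, D = shift_comb s >].

Lemma shift_comb_linear s : linear (shift_comb s).
Proof.
move=> a f g; rewrite /shift_comb scaler_sumr -big_split /=.
apply: eq_bigr => p _.
by rewrite shift_is_linear scalerDr !scalerA mulrC.
Qed.

HB.instance Definition _ s :=
  GRing.isLinear.Build R F F _ (shift_comb s) (shift_comb_linear s).

Lemma is_fdop_submod : submod_closed is_fdop.
Proof.
split=> [|a D E /asboolP[s ->] /asboolP[t ->]]; apply/asboolP.
  by exists [::]; apply/funext => f; rewrite /shift_comb big_nil.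
exists ([seq (a * p.1, p.2) | p <- s] ++ t); apply/funext => f.
transitivity (a *: shift_comb s f + shift_comb t f) => //.
rewrite /shift_comb big_cat big_map /=; congr (_ + _).
by rewrite scaler_sumr; apply: eq_bigr => p _; rewrite scalerA.
Qed.

HB.instance Definition _ :=
  GRing.isSubmodClosed.Build R (F -> F) is_fdop is_fdop_submod.

End FDOperators.

(* Finite real linear combinations of shifts. Addition and scaling are those of
   operators; multiplication, defined below, is composition. *)
Record fdop (R : realType) (d : nat) (dx : R) := FDOp {
  fdop_fun :> (lattice d dx -> R^o) -> (lattice d dx -> R^o);
  _ : fdop_fun \in is_fdop }.

Section FDRing.
Context {R : realType} {d : nat} {dx : R}.
Local Notation L := (lattice d dx).
Local Notation F := (L -> R^o).
Local Notation fdop := (fdop d dx).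

HB.instance Definition _ := [isSub for @fdop_fun R d dx].
HB.instance Definition _ := [Choice of fdop by <:].
HB.instance Definition _ := [SubChoice_isSubZmodule of fdop by <:].
HB.instance Definition _ := [SubZmodule_isSubLmodule of fdop by <:].

Lemma fdopE (D : fdop) : exists s, D = shift_comb s :> (F -> F).
Proof. by case: D => D /= /asboolP. Qed.

Lemma shift_is_fdop z : (@shift R d dx z : F -> F) \in is_fdop.
Proof.
apply/asboolP; exists [:: (1, z)]; apply/funext => f.
by rewrite /shift_comb big_seq1 scale1r.
Qed.

Definition fdshift (z : 'rV[int]_d) : fdop := FDOp (shift_is_fdop z).

Lemma shift_comb_comp s t f :
  @shift_comb R d dx s (shift_comb t f) =
  \sum_(p <- s) \sum_(r <- t) (p.1 * r.1) *: shift (p.2 + r.2) f.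
Proof.
apply: eq_bigr => p _; rewrite /shift_comb linear_sum scaler_sumr.
by apply: eq_bigr => r _; rewrite linearZ_LR scalerA shiftD mulrC.
Qed.

Lemma comp_is_fdop (D E : fdop) : (fun f => D (E f)) \in is_fdop.
Proof.
have [[s sE] [t tE]] := (fdopE D, fdopE E).
apply/asboolP; exists [seq (p.1 * r.1, p.2 + r.2) | p <- s, r <- t].
apply/funext => f; rewrite sE tE shift_comb_comp /shift_comb.
by rewrite big_allpairs_dep.
Qed.

Definition fdmul (D E : fdop) : fdop := FDOp (comp_is_fdop D E).

Lemma fdop_is_linear (D : fdop) : linear D.
Proof. by have [s ->] := fdopE D; exact: shift_comb_linear. Qed.

HB.instance Definition _ (D : fdop) :=
  GRing.isLinear.Build R F F _ (fdop_fun D) (fdop_is_linear D).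

Lemma fdop_eq (D E : fdop) : (forall f, D f = E f) -> D = E.
Proof. by move=> DE; apply/val_inj/funext. Qed.

Lemma fdmulA : associative fdmul.
Proof. by move=> D E G; apply: fdop_eq. Qed.

Lemma fdmulC : commutative fdmul.
Proof.
move=> D E; apply: fdop_eq => f /=.
have [[s ->] [t ->]] := (fdopE D, fdopE E).
rewrite !shift_comb_comp exchange_big; apply: eq_bigr => p _.
by apply: eq_bigr => r _; rewrite mulrC addrC.
Qed.

Lemma fdmul1 : left_id (fdshift 0) fdmul.
Proof. by move=> D; apply: fdop_eq => f /=; rewrite shift0. Qed.

Lemma fdmulDl : left_distributive fdmul +%R.
Proof. by move=> D E G; apply: fdop_eq. Qed.

Lemma fdone_neq0 : fdshift 0 != 0.
Proof.
apply/eqP => /(congr1 (fun D : fdop => D (fun=> 1) 0)) /=.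
by rewrite /shift /= => /eqP; rewrite oner_eq0.
Qed.

HB.instance Definition _ := GRing.Zmodule_isComNzRing.Build fdop
  fdmulA fdmulC fdmul1 fdmulDl fdone_neq0.

Lemma fdshiftD z w : fdshift (z + w) = fdshift z * fdshift w.
Proof. by apply: fdop_eq => f; exact: shiftD. Qed.

Lemma fdscaleAl (a : R) (D E : fdop) : a *: (D * E) = (a *: D) * E.
Proof. by apply: fdop_eq. Qed.

HB.instance Definition _ := GRing.Lmodule_isLalgebra.Build R fdop fdscaleAl.
HB.instance Definition _ := GRing.Lalgebra_isComAlgebra.Build R fdop.

Definition fdapply {p r} (C : 'M[fdop]_(p, r)) (v : 'cV[F]_r) : 'cV[F]_p :=
  \col_i \sum_j C i j (v j 0).

End FDRing.

Section LatticeBoltzmann.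
(* N is the number of conserved moments; they are the first N of the q ones. *)
Context {R : realType} {d : nat} (dx : R) (N : nat) {q : nat}.
Local Notation F := (lattice d dx -> R^o).

Definition relaxation (s : 'I_q -> R) : 'M[R]_q :=
  diag_mx (\row_i (if (i < N)%N then 0 else s i)).

(* Real scalars act as multiples of the identity shift. *)
Definition liftmx {p r} (C : 'M[R]_(p, r)) : 'M[fdop d dx]_(p, r) :=
  map_mx (in_alg (fdop d dx)) C.

Definition transport (c : 'I_q -> 'rV[int]_d) (M : 'M[R]_q) :
    'M[fdop d dx]_q :=
  liftmx M *m diag_mx (\row_i fdshift (c i)) *m liftmx (invmx M).

Definition lbA (c : 'I_q -> 'rV[int]_d) (M : 'M[R]_q) (s : 'I_q -> R) :
    'M[fdop d dx]_q :=
  transport c M *m liftmx (1%:M - relaxation s).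

Definition lbB (c : 'I_q -> 'rV[int]_d) (M : 'M[R]_q) (s : 'I_q -> R) :
    'M[fdop d dx]_q :=
  transport c M *m liftmx (relaxation s).

Definition at_equilibrium (Nq : (N <= q)%N) (meq : 'cV[R]_N -> 'cV[R]_q)
    (m : 'cV[F]_q) : 'cV[F]_q :=
  \col_i (fun x => meq (\col_j m (widen_ord Nq j) 0 x) i 0).

Definition lb_scheme (Nq : (N <= q)%N) (c : 'I_q -> 'rV[int]_d)
    (M : 'M[R]_q) (s : 'I_q -> R) (meq : 'cV[R]_N -> 'cV[R]_q)
    (m : nat -> 'cV[F]_q) :=
  forall n, m n.+1 =
    fdapply (lbA c M s) (m n) +
    fdapply (lbB c M s) (at_equilibrium Nq meq (m n)).

End LatticeBoltzmann.

Arguments at_equilibrium {R d dx N q} Nq meq m.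
Arguments lb_scheme {R d dx N q} Nq c M s meq m.

(* Main.v *)
(* Let $\gamma_k$ be the coefficients of the characteristic polynomial. Iterating
   $m^{n+1} = A m^n + w^n$ from time $p = n+1-q$ gives
   $m^{p+k} = A^k m^p + \sum_{l<k} A^l w^{p+k-1-l}$. Weighting by $\gamma_k$ and
   summing over $k \le q$, the contribution of $m^p$ is killed by
   Cayley-Hamilton; reindexing the remaining double sum by the age
   $j = q - k + l$ of the source term gives the formula, because
   $\gamma_q = 1$. *)

Require Import Defs.
From mathcomp Require Import all_boot all_order all_algebra.
From mathcomp Require Import functions reals.
From mathcomp Require Import zify.

Set Implicit Arguments.
Unset Strict Implicit.
Unset Printing Implicit Defensive.

Import Order.TTheory GRing.Theory Num.Theory.

Local Open Scope ring_scope.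

Section OperatorMatrices.
Context {R : realType} {d : nat} {dx : R}.
Local Notation F := (lattice d dx -> R^o).

Lemma fdapplyDr p r (C : 'M[fdop d dx]_(p, r)) (v w : 'cV[F]_r) :
  fdapply C (v + w) = fdapply C v + fdapply C w.
Proof.
apply/colP => i; rewrite !mxE -big_split; apply: eq_bigr => j _.
by rewrite mxE linearD.
Qed.

Lemma fdapply0r p r (C : 'M[fdop d dx]_(p, r)) :
  fdapply C (0 : 'cV[F]_r) = 0.
Proof. by apply/(addrI (fdapply C 0)); rewrite -fdapplyDr !addr0. Qed.

Lemma fdapply_sumr p r (C : 'M[fdop d dx]_(p, r)) (I : Type) (t : seq I)
    (P : pred I) (v : I -> 'cV[F]_r) :
  fdapply C (\sum_(i <- t | P i) v i) = \sum_(i <- t | P i) fdapply C (v i).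
Proof. exact: (big_morph _ (@fdapplyDr _ _ C) (@fdapply0r _ _ C)). Qed.

Lemma fdapplyDl p r (v : 'cV[F]_r) (C D : 'M[fdop d dx]_(p, r)) :
  fdapply (C + D) v = fdapply C v + fdapply D v.
Proof.
apply/colP => i; rewrite !mxE -big_split; apply: eq_bigr => j _.
by rewrite mxE.
Qed.

Lemma fdapply0l p r (v : 'cV[F]_r) :
  fdapply (0 : 'M[fdop d dx]_(p, r)) v = 0.
Proof. by apply/(addrI (fdapply 0 v)); rewrite -fdapplyDl !addr0. Qed.

Lemma fdapply_suml p r (v : 'cV[F]_r) (I : Type) (t : seq I) (P : pred I)
    (C : I -> 'M[fdop d dx]_(p, r)) :
  fdapply (\sum_(i <- t | P i) C i) v = \sum_(i <- t | P i) fdapply (C i) v.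
Proof.
exact: (big_morph (fdapply^~ v) (@fdapplyDl _ _ v) (@fdapply0l _ _ v)).
Qed.

Lemma fdop_suml (I : Type) (t : seq I) (P : pred I) (D : I -> fdop d dx)
    (f : F) :
  (\sum_(i <- t | P i) D i) f = \sum_(i <- t | P i) D i f.
Proof. exact: (big_morph (fun E : fdop d dx => E f)). Qed.

(** The product of [fdop] is composition and each entry of [C] is linear, so it passes through the
    inner sum. *)
Lemma fdapplyM p r t (C : 'M[fdop d dx]_(p, r)) (D : 'M[fdop d dx]_(r, t))
    (v : 'cV[F]_t) :
  fdapply (C *m D) v = fdapply C (fdapply D v).
Proof.
apply/colP => i; rewrite !mxE.
under eq_bigr => j _ do rewrite mxE fdop_suml.
rewrite exchange_big; apply: eq_bigr => k _.
by rewrite mxE linear_sum.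
Qed.

(** Scalar matrices let a single operator act on every component, so the weights $\gamma_k$ are also
    handled by [fdapply]. *)
Lemma fdapply_scalar r (D : fdop d dx) (v : 'cV[F]_r) i :
  fdapply D%:M v i 0 = D (v i 0).
Proof.
rewrite mxE (bigD1 i) //= mxE eqxx mulr1n big1 ?addr0 // => j ji.
by rewrite mxE eq_sym (negbTE ji).
Qed.

Lemma fdapply1 r (v : 'cV[F]_r) : fdapply 1%:M v = v.
Proof. by apply/colP => i; rewrite fdapply_scalar; exact: shift0. Qed.

Lemma fdapplyZ p r (D : fdop d dx) (C : 'M[fdop d dx]_(p, r)) (v : 'cV[F]_r) :
  fdapply (D *: C) v = fdapply D%:M (fdapply C v).
Proof. by rewrite -fdapplyM mul_scalar_mx. Qed.

(** Discrete Duhamel formula: a source emitted [l.+1] steps before time [p + k] has since been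
    propagated [l] times. *)
Lemma affine_recurrence r (C : 'M[fdop d dx]_r) (u w : nat -> 'cV[F]_r) :
  (forall n, u n.+1 = fdapply C (u n) + w n) ->
  forall p k, u (p + k)%N = fdapply (C ^+ k) (u p) +
    \sum_(0 <= l < k) fdapply (C ^+ l) (w (p + k - l.+1)%N).
Proof.
move=> uS p; elim=> [|k IH].
  by rewrite addn0 expr0 fdapply1 big_geq ?addr0.
rewrite addnS uS IH fdapplyDr -fdapplyM -addrA exprS; congr (_ + _).
(* The term [l = 0] is the newest source; every older one gains a factor [C]. *)
rewrite fdapply_sumr big_nat_recl // expr0 fdapply1 subn1 addrC; congr (_ + _).
by apply: eq_bigr => l _; rewrite -fdapplyM exprS subSS.
Qed.

End OperatorMatrices.

(** Cayley-Hamilton expanded into coefficients, the form in which the weighted sum meets it. *)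
Lemma Cayley_Hamilton_sum (K : comNzRingType) n (C : 'M[K]_n) :
  \sum_(k < n.+1) (char_poly C)`_k *: C ^+ k = 0.
Proof.
case: n C => [|n] C; first exact: flatmx0.
rewrite -[RHS](Cayley_Hamilton C) -{2}[char_poly C]coefK poly_def.
rewrite size_char_poly rmorph_sum; apply: eq_bigr => k _.
by rewrite /= horner_mxZ rmorphXn /= horner_mx_X.
Qed.

Lemma exchange_triangle (V : nmodType) n (f : nat -> nat -> V) :
  \sum_(0 <= k < n) \sum_(0 <= l < k.+1) f k l =
  \sum_(0 <= l < n) \sum_(l <= k < n) f k l.
Proof.
under [RHS]eq_bigr => l _ do rewrite (big_nat_widenl _ 0) //.
rewrite [RHS](exchange_big_dep_nat xpredT) //=; apply: eq_big_nat => k kn.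
by rewrite (big_nat_widen 0 k.+1 n).
Qed.

(** Substitution $j = n - k + l$: for fixed [l] it reverses the range of [k], so both sums are first
    put with [l] outermost. *)
Lemma triangle_reindex (V : nmodType) n (f : nat -> nat -> V) :
  \sum_(0 <= k < n.+1) \sum_(0 <= l < k) f k l =
  \sum_(0 <= j < n) \sum_(0 <= l < j.+1) f (n + l - j)%N l.
Proof.
rewrite big_nat_recl // [X in X + _]big_geq // add0r.
rewrite (exchange_triangle n (fun k => f k.+1)).
rewrite (exchange_triangle n (fun j l => f (n + l - j)%N l)).
apply: eq_bigr => l _; rewrite big_nat_rev /=; apply: eq_big_nat => k kn.
by congr (f _ _); lia.
Qed.

Lemma multistep_recurrence (R : realType) (d : nat) (dx : R) r
    (C : 'M[fdop d dx]_r) (u w : nat -> 'cV[lattice d dx -> R^o]_r) :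
  (forall n, u n.+1 = fdapply C (u n) + w n) ->
  let gamma k := (char_poly C)`_k in
  forall p, \sum_(k < r.+1) fdapply (gamma k)%:M (u (p + k)%N) =
    \sum_(j < r) fdapply (\sum_(l < j.+1) gamma (r + l - j)%N *: C ^+ l)
      (w (p + r - j.+1)%N).
Proof.
move=> uS gamma p.
under eq_bigr => k _ do
  rewrite (affine_recurrence uS) fdapplyDr -fdapplyZ fdapply_sumr.
(* The terms in [u p] gather into $\chi_C(C)$ applied to [u p]. *)
rewrite big_split /= -fdapply_suml Cayley_Hamilton_sum fdapply0l add0r.
rewrite -(big_mkord xpredT (fun k => \sum_(0 <= l < k) fdapply (gamma k)%:M
  (fdapply (C ^+ l) (w (p + k - l.+1)%N)))) triangle_reindex big_mkord.
apply: eq_bigr => j _; rewrite fdapply_suml big_mkord; apply: eq_bigr => l _.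
rewrite fdapplyZ; congr (fdapply _ (fdapply _ (w _))).
(* With $k = r + l - j$, the time $p + k - l - 1$ equals $p + r - j - 1$, independent of [l]; the
   bounds $l \le j < r$ keep the subtractions exact. *)
have := ltn_ord j; have := ltn_ord l; lia.
Qed.

Theorem proposition4 (R : realType) (d : nat) (hd : (1 <= d <= 3)%N)
    (dx : R) (hdx : 0 < dx)
    (q : nat) (hq : (1 < q)%N)
    (c : 'I_q -> 'rV[int]_d)
    (M : 'M[R]_q) (hM : M \in unitmx)
    (s : 'I_q -> R) (hs : forall i : 'I_q, (1 <= i)%N -> 0 < s i <= 2)
    (meq : 'cV[R]_1 -> 'cV[R]_q)
    (m : nat -> 'cV[lattice d dx -> R^o]_q)
    (hm : lb_scheme (ltnW hq) c M s meq m) :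
  let A : 'M[fdop d dx]_q := lbA dx 1 c M s in
  let B : 'M[fdop d dx]_q := lbB dx 1 c M s in
  let gamma (k : nat) : fdop d dx := (char_poly A)`_k in
  let first : 'I_q := widen_ord (ltnW hq) ord0 in
  forall n : nat, (q - 1 <= n)%N ->
    m n.+1 first 0 =
      - (\sum_(k < q) gamma k (m (n.+1 - q + k)%N first 0))
      + (\sum_(k < q)
           fdapply
             ((\sum_(l < k.+1) gamma (q + l - k)%N *: A ^+ l) *m B)
             (at_equilibrium (ltnW hq) meq (m (n - k)%N))) first 0.
Proof.
move=> A B gamma first n qn.
(* The bound on [n] makes the starting time $n + 1 - q$ a true difference. *)
have nE : n.+1 = (n.+1 - q + q)%N by lia.
(* The possibly nonlinear equilibrium enters only through the source [w]. *)
have := multistep_recurrence hm (n.+1 - q).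
rewrite big_ord_recr /= -nE => /(congr1 (fun v : 'cV_q => v first 0)).
(* Monicity turns the top term into $m^{n+1}$ itself, which makes the scheme explicit. *)
have -> : (char_poly A)`_q = 1.
  have := monicP (char_poly_monic A).
  by rewrite lead_coefE size_char_poly.
rewrite fdapply1 mxE summxE => /(canRL (addKr _)) ->; congr (- _ + _).
  by apply: eq_bigr => k _; rewrite fdapply_scalar.
congr (fun_of_matrix _ first 0).
apply: eq_bigr => j _; rewrite fdapplyM.
by congr (fdapply _ (fdapply _ (at_equilibrium _ _ (m _)))); lia.
Qed.
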